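(* Let $p = 2j/(2j-1)$ for some integer $j>1$. If $H \in L^{2j}$ and $\hat H(n) \ge 0$ for all integers $n$, then $(\overline H)^{j-1}H^j$ is its own minimal majorant in $L^p$.
   Context: $L^p$ denotes the space of complex-valued ($2\pi$-periodic) functions on $[-\pi,\pi)$ with norm $\|f\|_p = \left(\frac{1}{2\pi}\int_{-\pi}^{\pi}|f(\theta)|^p\,d\theta\right)^{1/p}$, and $\hat f(n) = \frac{1}{2\pi}\int_{-\pi}^\pi f(\theta)e^{-in\theta}\,d\theta$ for integers $n$. A function $F$ is a majorant of $f$ when $|\hat f(n)| \le \hat F(n)$ for all integers $n$; the minimal majorant of $f$ in $L^p$ is the unique majorant of $f$ in $L^p$ of least $L^p$ norm. *)

(* Defs.v *)
From HB Require Import structures.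
From mathcomp Require Import all_boot all_order all_algebra complex.
From mathcomp Require Import all_classical all_reals all_analysis.
Set Implicit Arguments.
Unset Strict Implicit.
Unset Printing Implicit Defensive.
Import Order.TTheory GRing.Theory Num.Theory.
Import numFieldNormedType.Exports.
Local Open Scope classical_set_scope.
Local Open Scope ring_scope.
Local Open Scope complex_scope.

Section circle.
Context {R : realType}.
Implicit Types (f F G : R -> R[i]) (p : R).

Definition circle : set R := `[- pi, pi[.

Local Notation leb := (@lebesgue_measure R).

(* The norm of R[i] takes its values in R[i]; this is the same number in R. *)
Definition cmod (z : R[i]) : R := complex.Re `|z|.

Definition expi (t : R) : R[i] := cos t +i* sin t.

Definition Cintegral (D : set R) f : R[i] :=
  (\int[leb]_(t in D) complex.Re (f t)) +i* (\int[leb]_(t in D) complex.Im (f t)).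

Definition Lp_norm p f : \bar R :=
  ((((2 * pi)^-1)%:E * \int[leb]_(t in circle) (cmod (f t) `^ p)%:E) `^ p^-1)%E.

(* Elements are functions, not classes; equality in L^p is [ae_eq lebesgue_measure circle]. *)
Definition in_Lp p f : Prop :=
  [/\ periodic f (2 * pi),
      measurable_fun circle (fun t => complex.Re (f t)),
      measurable_fun circle (fun t => complex.Im (f t)) &
      (Lp_norm p f < +oo)%E].

Definition fourier f (n : int) : R[i] :=
  ((2 * pi)^-1)%:C * Cintegral circle (fun t => f t * expi (- (n%:~R * t))).

(* In R[i], x <= y means that y - x is a nonnegative real; so a majorant has
   real nonnegative Fourier coefficients. *)
Definition majorant F f : Prop := forall n : int, `|fourier f n| <= fourier F n.

Definition least_norm_majorant p f F : Prop :=
  [/\ in_Lp p F, majorant F f &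
      forall G, in_Lp p G -> majorant G f -> (Lp_norm p F <= Lp_norm p G)%E].

Definition minimal_majorant p f F : Prop :=
  least_norm_majorant p f F /\
  forall G, least_norm_majorant p f G -> ae_eq leb circle G F.

End circle.

(* Main.v *)
Require Import Defs.
From HB Require Import structures.
From mathcomp Require Import all_boot all_order all_algebra complex.
From mathcomp Require Import all_classical all_reals all_analysis.
From mathcomp Require Import measurable_realfun zify ring lra.
Set Implicit Arguments.
Unset Strict Implicit.
Unset Printing Implicit Defensive.
Import Order.TTheory GRing.Theory Num.Theory.
Import numFieldNormedType.Exports.
Local Open Scope classical_set_scope.
Local Open Scope complex_scope.
Local Open Scope ring_scope.

(**
Write q = 2j, so that p and q are conjugate exponents, and G = conj(H)^(j-1) H^j.
Since |G| = |H|^(q-1), the function H is, up to conjugation, the extremal function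
of Hoelder's inequality for G: G conj(H) = |H|^q = |G|^p.

Everything rests on one positivity principle, [Cintegral_mul_ge0]: if f in L^p and
g in L^q have nonnegative Fourier coefficients, then the integral of f g is
nonnegative, because Parseval would make it a sum of products of coefficients.
Multiplying g by a character turns this into the statement that f g again has
nonnegative coefficients ([fourier_mul_ge0]).  It is used twice.

- Applied along the product G, it shows that G has nonnegative coefficients, hence
  that G is a majorant of itself.
- If F in L^p is a majorant of G, then F - G and conj(H) have nonnegative
  coefficients, so the integral of |H|^q = G conj(H) is at most that of
  Re (F conj(H)).  By Young's inequality
  Re (F conj(H)) <= |F|^p / p + |H|^q / q, and the integral of |G|^p is that of
  |H|^q, so comparing the two bounds gives |G|_p <= |F|_p.  If the norms are equal
  then Young's inequality is an equality almost everywhere, and its equality case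
  forces F = G pointwise ([young_cmod_eq]).

Parseval for a pair (f, g) in L^p x L^q is replaced by a Cesaro version
([fejer_form_cvg]): the bilinear form obtained by integrating f(y) g(x) K_N(x - y),
with K_N the Fejer kernel, converges to 2 pi times the integral of f g, and by
[fejer_formE] it is a finite combination, with positive weights, of products of
coefficients.
As K_N (x - y) is a finite sum of products of a function of x and a function of y,
interchanging the two integrals needs no form of Fubini's theorem; and the
convergence is obtained without translating f or g, by

- the Fejer kernel being nonnegative with constant mass, which bounds the form
  uniformly in N by any separable bound al(y) + be(x) of |f(y) g(x)|
  ([fejer_form_bound]);
- such bounds being small for the remainder of a truncation of f (by Young's
  inequality), and, when f is bounded, for the remainder of an approximation of g
  in L^1 by continuous functions;
- pointwise convergence of Fejer means at points of continuity, and dominated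
  convergence, for f bounded and g continuous.
*)

(** * Integration on the circle *)

Section real_circle.
Context {R : realType}.
Implicit Types (f g h : R -> R) (x y s r M : R).
Local Notation mu := (@lebesgue_measure R).
Local Notation C := (@circle R).
Local Notation intg f := (mu.-integrable C (EFin \o f)).

Lemma measurable_circle : measurable C.
Proof. exact: measurable_itv. Qed.
Hint Resolve measurable_circle : core.

Lemma circle_measure : mu C = (2 * pi)%:E.
Proof.
rewrite /circle lebesgue_measure_itv /= lte_fin gtrN ?pi_gt0//.
by rewrite -EFinB opprK mulr_natl mulr2n.
Qed.

Lemma integrable_le f g : measurable_fun C f -> intg g ->
  (forall x, C x -> `|f x| <= g x) -> intg f.
Proof.
move=> mf ig fg; apply: (le_integrable _ _ _ ig) => //.
  exact/measurable_EFinP.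
by move=> x Cx /=; rewrite lee_fin (le_trans (fg _ Cx))// ler_norm.
Qed.

Lemma integrable_bounded f M : measurable_fun C f ->
  (forall x, C x -> `|f x| <= M) -> intg f.
Proof.
move=> mf fM; apply: measurable_bounded_integrable => //.
  by rewrite [X in (X < _)%E]circle_measure ltry.
exists M; split; first exact: num_real.
by move=> K MK x /= Cx; rewrite (le_trans (fM _ Cx))// ltW.
Qed.

Lemma integrable_circle_cst r : intg (fun=> r).
Proof. exact: (@integrable_bounded _ `|r|). Qed.

Lemma integrable_mulb f g M : intg f -> measurable_fun C g ->
  (forall x, C x -> `|g x| <= M) -> intg (fun x => f x * g x).
Proof.
move=> If mg gM; have [mf _] := integrableP _ _ _ If.
apply: (@integrable_le _ (fun x => M * `|f x|)).
- by apply: measurable_funM => //; exact/measurable_EFinP.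
- exact: (integrableZl _ M (integrable_norm If)).
- by move=> x Cx; rewrite normrM mulrC ler_wpM2r// gM.
Qed.

Lemma integrable_addr f g : intg f -> intg g -> intg (fun x => f x + g x).
Proof. by move=> If Ig; apply: (integrableD _ If Ig). Qed.

Lemma integrable_subr f g : intg f -> intg g -> intg (fun x => f x - g x).
Proof. by move=> If Ig; apply: (integrableB _ If Ig). Qed.

Lemma integrable_mulr f r : intg f -> intg (fun x => r * f x).
Proof. by move=> If; apply: (integrableZl _ r If). Qed.

Lemma integrable_sumr (I : Type) (s : seq I) (F : I -> R -> R) :
  (forall i, intg (F i)) -> intg (fun x => \sum_(i <- s) F i x).
Proof.
move=> IF; elim: s => [|i s IH].
  by under eq_fun do rewrite big_nil; exact: integrable_circle_cst.
by under eq_fun do rewrite big_cons; exact: integrable_addr.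
Qed.

Lemma Rintegral_sumr (I : Type) (s : seq I) (F : I -> R -> R) :
  (forall i, intg (F i)) ->
  \int[mu]_(x in C) (\sum_(i <- s) F i x) = \sum_(i <- s) \int[mu]_(x in C) F i x.
Proof.
move=> IF; elim: s => [|i s IH].
  rewrite big_nil; under eq_Rintegral do rewrite big_nil.
  by rewrite Rintegral_cst// mul0r.
rewrite big_cons -IH -RintegralD//; last exact: integrable_sumr.
by apply: eq_Rintegral => x _; rewrite big_cons.
Qed.

Lemma Rintegral_circle_cst r : \int[mu]_(x in C) r = r * (2 * pi).
Proof. by rewrite Rintegral_cst// [X in fine X]circle_measure. Qed.

(** * Trigonometric integrals *)

Lemma continuous_derive f (df : R -> R) :
  (forall x, is_derive x 1 f (df x)) -> continuous f.
Proof.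
by move=> fd x; apply/differentiable_continuous/derivable1_diffP; have [] := fd x.
Qed.

Lemma Rintegral_circle_derive f (df : R -> R) : continuous df ->
  (forall x, is_derive x 1 f (df x)) ->
  \int[mu]_(x in C) df x = f pi - f (- pi).
Proof.
move=> cdf fd; have cf := continuous_derive fd.
have pipi : - pi < pi :> R by rewrite gtrN ?pi_gt0.
have cdf' : {within `[- pi, pi], continuous df}.
  exact: continuous_subspaceT.
rewrite Rintegral_itv_bndo_bndc; last first.
  apply: (integrableS _ _ _ (continuous_compact_integrable _ cdf')) => //.
  - exact: subset_itv_co_cc.
  - exact: segment_compact.
rewrite /Rintegral (continuous_FTC2 pipi cdf' (F := f)) ?EFinB//.
- split.
  + by move=> x _; have [] := fd x.
  + by apply: cvg_at_right_filter; exact: cf.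
  + by apply: cvg_at_left_filter; exact: cf.
- by move=> x _; rewrite derive1E; apply: derive_val.
Qed.

Lemma sin_intpi (m : int) : sin (m%:~R * pi) = 0 :> R.
Proof.
have sn (n : nat) : sin (n%:R * pi) = 0 :> R.
  elim: n => [|n IH]; first by rewrite mul0r sin0.
  by rewrite -natr1 mulrDl mul1r sinDpi IH oppr0.
by case: m => n; rewrite ?NegzE ?mulrNz ?mulNr ?sinN sn ?oppr0.
Qed.

Lemma is_derive_scale (k x : R) : is_derive x 1 (fun y => k * y) k.
Proof.
have /= := is_deriveZ k (is_derive_id x (1 : R)).
by rewrite /GRing.scale/= mulr1.
Qed.

Lemma continuous_cos_scale (k : R) : continuous (fun x => cos (k * x)).
Proof.
by move=> x; apply: continuous_comp; [exact: mulrl_continuous|exact: continuous_cos].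
Qed.

Lemma continuous_sin_scale (k : R) : continuous (fun x => sin (k * x)).
Proof.
by move=> x; apply: continuous_comp; [exact: mulrl_continuous|exact: continuous_sin].
Qed.

Lemma Rintegral_circle_sin (m : int) : \int[mu]_(x in C) sin (m%:~R * x) = 0.
Proof.
have [->|m0] := eqVneq m 0.
  under eq_Rintegral do rewrite mul0r sin0.
  by rewrite Rintegral_circle_cst mul0r.
have mR0 : m%:~R != 0 :> R by rewrite intr_eq0.
have D x : is_derive x 1 (fun y => - (m%:~R)^-1 * cos (m%:~R * y)) (sin (m%:~R * x)).
  have := is_derive1_comp (is_derive_cos (m%:~R * x)) (is_derive_scale m%:~R x).
  move=> /(is_deriveZ (- (m%:~R)^-1)) H; apply: (is_derive_eq H).
  by rewrite /GRing.scale/=; field.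
rewrite (Rintegral_circle_derive _ D); last exact: continuous_sin_scale.
by rewrite mulrN cosN subrr.
Qed.

Lemma Rintegral_circle_cos (m : int) :
  \int[mu]_(x in C) cos (m%:~R * x) = 2 * pi * (m == 0)%:R.
Proof.
have [->|m0] := eqVneq m 0.
  under eq_Rintegral do rewrite mul0r cos0.
  by rewrite Rintegral_circle_cst mul1r mulr1.
have mR0 : m%:~R != 0 :> R by rewrite intr_eq0.
have D x : is_derive x 1 (fun y => (m%:~R)^-1 * sin (m%:~R * y)) (cos (m%:~R * x)).
  have := is_derive1_comp (is_derive_sin (m%:~R * x)) (is_derive_scale m%:~R x).
  move=> /(is_deriveZ (m%:~R)^-1) H; apply: (is_derive_eq H).
  by rewrite /GRing.scale/=; field.
rewrite (Rintegral_circle_derive _ D); last exact: continuous_cos_scale.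
by rewrite mulrN sinN sin_intpi oppr0 !mulr0 subrr.
Qed.

(** * The Fejer kernel and its bilinear form *)

Definition cos_coef (m : int) f := \int[mu]_(x in C) (f x * cos (m%:~R * x)).
Definition sin_coef (m : int) f := \int[mu]_(x in C) (f x * sin (m%:~R * x)).

Lemma integrable_cos (m : int) f : intg f -> intg (fun x => f x * cos (m%:~R * x)).
Proof.
move=> If; apply: (@integrable_mulb _ _ 1) => //.
  by apply: measurable_funTS; apply: continuous_measurable_fun; exact: continuous_cos_scale.
by move=> x _; rewrite cos_max.
Qed.

Lemma integrable_sin (m : int) f : intg f -> intg (fun x => f x * sin (m%:~R * x)).
Proof.
move=> If; apply: (@integrable_mulb _ _ 1) => //.
  by apply: measurable_funTS; apply: continuous_measurable_fun; exact: continuous_sin_scale.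
by move=> x _; rewrite sin_max.
Qed.

(** Differences of two indices below N carry exactly the Fejer weights: the frequency
    k occurs N - |k| times, so that sums over pairs need no explicit weights. *)
Definition freq N (k : 'I_N * 'I_N) : int := k.1%:Z - k.2%:Z.

Definition fejer N s : R := N%:R^-1 * \sum_(k : 'I_N * 'I_N) cos ((freq k)%:~R * s).

(** The double sum is the squared modulus of the sum of the e^(i a s), a < N. *)
Lemma fejerE N s : fejer N s =
  N%:R^-1 * ((\sum_(a < N) cos (a%:R * s)) ^+ 2 + (\sum_(a < N) sin (a%:R * s)) ^+ 2).
Proof.
congr (_ * _); rewrite !expr2 !big_distrlr/= !pair_big -big_split/=.
apply: eq_bigr => -[a b] _ /=.
by rewrite /freq/= rmorphB/= mulrBl cosB.
Qed.

Lemma fejer_ge0 N s : 0 <= fejer N s.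
Proof. by rewrite fejerE mulr_ge0 ?invr_ge0// addr_ge0 ?sqr_ge0. Qed.

(** Multiplying the geometric sum of the e^(i a s) by e^(i s) - 1 telescopes to
    e^(i N s) - 1, whose squared modulus is at most 4, and 2 - 2 cos s is the squared
    modulus of e^(i s) - 1.  This form of the decay away from 0 has no singularity. *)
Lemma fejer_decay N s : fejer N s * (2 - 2 * cos s) <= 4 / N%:R.
Proof.
rewrite fejerE; set c := \sum_(_ < _) _; set d := \sum_(_ < _) _.
have [e1 e2] : c * (cos s - 1) - d * sin s = cos (N%:R * s) - 1 /\
               c * sin s + d * (cos s - 1) = sin (N%:R * s).
  rewrite {}/c {}/d; elim: N => [|N [IH1 IH2]].
    by rewrite !big_ord0 !mul0r cos0 sin0 !subrr addr0.
  have -> : N.+1%:R * s = N%:R * s + s by rewrite -natr1 mulrDl mul1r.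
  by rewrite !big_ord_recr/= cosD sinD; split; lra.
have cs t : cos t ^+ 2 + sin t ^+ 2 = 1 :> R by exact: cos2Dsin2.
rewrite [leRHS]mulrC -mulrA ler_wpM2l ?invr_ge0//.
have -> : (c ^+ 2 + d ^+ 2) * (2 - 2 * cos s) =
    (c * (cos s - 1) - d * sin s) ^+ 2 + (c * sin s + d * (cos s - 1)) ^+ 2.
  have := cs s; move: (cos s) (sin s) => u v uv.
  have -> : 2 - 2 * u = (u - 1) ^+ 2 + v ^+ 2 by lra.
  by ring.
rewrite e1 e2; have := cs (N%:R * s); have := cos_geN1 (N%:R * s).
by move: (cos _) (sin _) => u v; lra.
Qed.

Definition fejer_mean N f y := \int[mu]_(x in C) (f x * fejer N (x - y)).
Definition fejer_form N f g := \int[mu]_(y in C) (f y * fejer_mean N g y).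

(** The addition formula separates the variables; this is what makes the Fejer means
    and the Fejer form finite combinations of coefficients. *)
Lemma mul_fejerE N f x y : f x * fejer N (x - y) =
  \sum_(k : 'I_N * 'I_N) N%:R^-1 *
     (cos ((freq k)%:~R * y) * (f x * cos ((freq k)%:~R * x)) +
      sin ((freq k)%:~R * y) * (f x * sin ((freq k)%:~R * x))).
Proof.
rewrite /fejer mulrCA -mulr_sumr; congr (_ * _); rewrite mulr_sumr.
by apply: eq_bigr => k _; rewrite mulrBr cosB; ring.
Qed.

Lemma integrable_mul_fejer N f y : intg f -> intg (fun x => f x * fejer N (x - y)).
Proof.
move=> If; under eq_fun do rewrite mul_fejerE.
apply: integrable_sumr => k; apply: integrable_mulr.
by apply: integrable_addr; apply: integrable_mulr; [exact: integrable_cos|exact: integrable_sin].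
Qed.

Lemma fejer_meanE N f y : intg f -> fejer_mean N f y =
  \sum_(k : 'I_N * 'I_N) N%:R^-1 *
     (cos ((freq k)%:~R * y) * cos_coef (freq k) f +
      sin ((freq k)%:~R * y) * sin_coef (freq k) f).
Proof.
move=> If; rewrite /fejer_mean; under eq_Rintegral do rewrite mul_fejerE.
have Ic k := integrable_cos k If; have Is k := integrable_sin k If.
rewrite Rintegral_sumr => [|k]; last first.
  by apply: integrable_mulr; apply: integrable_addr; exact: integrable_mulr.
apply: eq_bigr => k _; rewrite RintegralZl//; last first.
  by apply: integrable_addr; exact: integrable_mulr.
by rewrite RintegralD ?RintegralZl//; exact: integrable_mulr.
Qed.

Lemma mul_fejer_meanE N f g y : intg g -> f y * fejer_mean N g y =
  \sum_(k : 'I_N * 'I_N) N%:R^-1 *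
     (cos_coef (freq k) g * (f y * cos ((freq k)%:~R * y)) +
      sin_coef (freq k) g * (f y * sin ((freq k)%:~R * y))).
Proof.
by move=> Ig; rewrite fejer_meanE// mulr_sumr; apply: eq_bigr => k _; ring.
Qed.

Lemma integrable_mul_fejer_mean N f g : intg f -> intg g ->
  intg (fun y => f y * fejer_mean N g y).
Proof.
move=> If Ig; under eq_fun do rewrite mul_fejer_meanE//.
apply: integrable_sumr => k; apply: integrable_mulr.
by apply: integrable_addr; apply: integrable_mulr; [exact: integrable_cos|exact: integrable_sin].
Qed.

Lemma fejer_formE N f g : intg f -> intg g -> fejer_form N f g =
  \sum_(k : 'I_N * 'I_N) N%:R^-1 *
     (cos_coef (freq k) f * cos_coef (freq k) g +
      sin_coef (freq k) f * sin_coef (freq k) g).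
Proof.
move=> If Ig; rewrite /fejer_form; under eq_Rintegral do rewrite mul_fejer_meanE//.
have Ic k := integrable_cos k If; have Is k := integrable_sin k If.
rewrite Rintegral_sumr => [|k]; last first.
  by apply: integrable_mulr; apply: integrable_addr; exact: integrable_mulr.
apply: eq_bigr => k _; rewrite RintegralZl//; last first.
  by apply: integrable_addr; exact: integrable_mulr.
rewrite RintegralD ?RintegralZl//; try exact: integrable_mulr.
by congr (_ * (_ + _)); exact: mulrC.
Qed.

(** Exchanging the order of integration in the Fejer form. *)
Lemma fejer_formC N f g : intg f -> intg g -> fejer_form N f g = fejer_form N g f.
Proof.
by move=> If Ig; rewrite !fejer_formE//; apply: eq_bigr => k _; ring.
Qed.

(** Only the N diagonal pairs, of frequency 0, contribute: the kernel has mass 2 pi. *)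
Lemma fejer_mean_cst N r y : (0 < N)%N -> fejer_mean N (fun=> r) y = r * (2 * pi).
Proof.
move=> N0; rewrite fejer_meanE; last exact: integrable_circle_cst.
have I1 := integrable_circle_cst 1.
have E (k : 'I_N * 'I_N) : N%:R^-1 *
     (cos ((freq k)%:~R * y) * cos_coef (freq k) (fun=> r) +
      sin ((freq k)%:~R * y) * sin_coef (freq k) (fun=> r)) =
    N%:R^-1 * (r * (2 * pi)) * (k.1 == k.2)%:R.
  rewrite /cos_coef /sin_coef.
  rewrite RintegralZl//; last first.
    by have := integrable_cos (freq k) I1; under eq_fun do rewrite mul1r.
  rewrite RintegralZl//; last first.
    by have := integrable_sin (freq k) I1; under eq_fun do rewrite mul1r.
  rewrite Rintegral_circle_cos Rintegral_circle_sin /freq subr_eq0.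
  rewrite (_ : (k.1%:Z == k.2%:Z) = (k.1 == k.2))//.
  have [->|] := eqVneq k.1 k.2; last by rewrite !(mulr0, addr0).
  by rewrite subrr mul0r cos0 sin0; ring.
rewrite (eq_bigr _ (fun k _ => E k)) -mulr_sumr -(pair_bigA _ (fun a b => (a == b)%:R))/=.
rewrite (eq_bigr (fun=> 1)); last first.
  by move=> a _; rewrite (bigD1 a)//= eqxx big1 ?addr0// => b /negPf; rewrite eq_sym => ->.
rewrite sumr_const card_ord; have : N%:R != 0 :> R by rewrite pnatr_eq0 -lt0n.
by move=> ?; field.
Qed.

(** Replacing |f(y) g(x)| by al(y) + be(x) under the nonnegative kernel, the first term
    integrates in x by [fejer_mean_cst], the second in y after [fejer_formC]. *)
Lemma fejer_form_bound N f g (al be : R -> R) : (0 < N)%N ->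
  intg f -> intg g -> intg al -> intg be ->
  (forall x y, C x -> C y -> `|f y * g x| <= al y + be x) ->
  `|fejer_form N f g| <=
    2 * pi * (\int[mu]_(x in C) al x + \int[mu]_(x in C) be x).
Proof.
move=> N0 If Ig Ial Ibe fg.
have Ifg := integrable_mul_fejer_mean N If Ig.
have I1 := integrable_circle_cst 1.
have Ibm := integrable_mul_fejer_mean N I1 Ibe.
have bound y : C y ->
    `|f y * fejer_mean N g y| <= al y * (2 * pi) + 1 * fejer_mean N be y.
  move=> Cy; have IgK := integrable_mul_fejer N y Ig.
  have IbK := integrable_mul_fejer N y Ibe.
  have IaK := integrable_mul_fejer N y (integrable_circle_cst (al y)).
  rewrite mul1r -(fejer_mean_cst _ y N0) -RintegralD// -RintegralZl//.
  have IfgK := integrable_mulr (f y) IgK.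
  rewrite (le_trans (le_normr_Rintegral _ IfgK))//.
  apply: le_Rintegral => //; first exact: (integrable_norm IfgK).
    exact: integrable_addr.
  move=> x Cx; rewrite mulrA normrM (ger0_norm (fejer_ge0 _ _)) -mulrDl.
  by rewrite ler_wpM2r ?fejer_ge0// fg.
rewrite (le_trans (le_normr_Rintegral _ Ifg))//.
have Ial2 : intg (fun y => al y * (2 * pi)).
  by under eq_fun do rewrite mulrC; exact: integrable_mulr.
rewrite (le_trans (le_Rintegral _ (integrable_norm Ifg) _ bound))//.
  exact: integrable_addr.
rewrite RintegralD// RintegralZr// (mulrDr (2 * pi)) (mulrC _ (2 * pi)) lerD2l.
rewrite -/(fejer_form N (fun=> 1) be) fejer_formC// /fejer_form.
under eq_Rintegral do rewrite fejer_mean_cst// mul1r.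
by rewrite RintegralZr// mulrC.
Qed.

(** * Convergence of the Fejer form *)

Lemma cos_le_cos_dist (d s : R) : 0 <= d -> d <= `|s| -> `|s| <= 2 * pi - d -> cos s <= cos d.
Proof.
move=> d0 ds sd; have -> : cos s = cos `|s| by case: ger0P => //; rewrite cosN.
have [spi|pis] := leP `|s| pi.
  by rewrite leNgt ltr_cos -?leNgt// in_itv/= ?d0 ?(le_trans ds)// (le_trans d0 ds).
have -> : cos `|s| = cos (2 * pi - `|s|).
  by rewrite -[RHS]cosN opprB mulr_natl -[in LHS](subrK (pi *+ 2) `|s|) cosD2pi.
rewrite leNgt ltr_cos ?in_itv/= -?leNgt; first lra.
  by apply/andP; split; lra.
by apply/andP; split; lra.
Qed.

(** Continuity at y controls the points x near y; elsewhere 2 - 2 cos (x - y) is bounded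
    below, because an interior point y keeps |x - y| away from 2 pi as well as from 0.
    Stated with 2 - 2 cos so as to be integrated against [fejer_decay]. *)
Lemma fejer_modulus g M y : - pi < y < pi -> (forall x, C x -> `|g x| <= M) ->
  {for y, continuous g} -> forall e : R, 0 < e ->
  exists2 K, 0 <= K & forall x, C x -> `|g x - g y| <= e + K * (2 - 2 * cos (x - y)).
Proof.
move=> /andP[y1 y2] gM gy e e0.
have Cy : C y by rewrite /circle/= in_itv/= ltW.
have M0 : 0 <= M by apply: le_trans (gM _ Cy).
have /cvgrPdist_lt /(_ e e0) /nbhs_ballP[d0 /= d0gt0 dP] := gy.
(* d <= pi - |y| ensures |x - y| <= 2 pi - d for every x of the circle. *)
pose d := Num.min d0 (Num.min (pi - y) (pi + y)).
have dgt0 : 0 < d by rewrite !lt_min d0gt0/=; apply/andP; split; lra.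
have [dd0 dy1 dy2] : [/\ d <= d0, d <= pi - y & d <= pi + y].
  by rewrite !ge_min !lexx !orbT.
have dpi : d <= pi by lra.
have cd : 0 < 2 - 2 * cos d.
  have : cos d < cos 0 by rewrite ltr_cos// in_itv/= ?lexx ?pi_ge0 ?(ltW dgt0).
  by rewrite cos0; lra.
exists (2 * M / (2 - 2 * cos d)); first by rewrite divr_ge0 ?mulr_ge0// ltW.
move=> x Cx; have /andP[x1 x2] : - pi <= x < pi by move: Cx; rewrite /circle/= in_itv.
have cx : 0 <= 2 - 2 * cos (x - y) by have := cos_le1 (x - y); lra.
have [xy|xy] := ltP `|x - y| d.
  rewrite ler_wpDr//; first by rewrite mulr_ge0// divr_ge0 ?mulr_ge0// ltW.
  rewrite distrC ltW//; apply: dP; rewrite /ball/= distrC.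
  exact: lt_le_trans dd0.
have c2 : 2 - 2 * cos d <= 2 - 2 * cos (x - y).
  have : cos (x - y) <= cos d.
    apply: cos_le_cos_dist => //; first exact: ltW.
    by rewrite ler_norml; apply/andP; split; lra.
  lra.
rewrite (le_trans (ler_normB _ _))// ler_wpDl ?(ltW e0)//.
rewrite (@le_trans _ _ (2 * M))//.
  by have := gM _ Cx; have := gM _ Cy; lra.
by rewrite mulrAC ler_pdivlMr// ler_wpM2l// mulr_ge0.
Qed.

Lemma fejer_mean_cvg g M y : - pi < y < pi -> intg g ->
  (forall x, C x -> `|g x| <= M) -> {for y, continuous g} ->
  fejer_mean N.+1 g y @[N --> \oo] --> g y * (2 * pi).
Proof.
move=> ypi Ig gM gy; apply/cvgrPdist_le => e e0.
have pi0 : 0 < 2 * pi :> R by rewrite mulr_gt0 ?pi_gt0.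
have [K K0 gK] := fejer_modulus ypi gM gy (divr_gt0 (divr_gt0 e0 pi0) (ltr0n R 2)).
near=> N; have N0 : 0 < N.+1%:R :> R by [].
have NK : K * 4 * (2 * pi) * 2 <= e * N.+1%:R.
  rewrite -ler_pdivrMl// mulrC.
  rewrite (@le_trans _ _ N%:R) ?ler_nat//.
  by near: N; exact: nbhs_infty_ger.
have Icg := integrable_mul_fejer N.+1 y (integrable_circle_cst (g y)).
have Igg := integrable_mul_fejer N.+1 y Ig.
have Ie := integrable_mul_fejer N.+1 y (integrable_circle_cst (e / (2 * pi) / 2)).
rewrite distrC -(fejer_mean_cst (g y) y (ltn0Sn N)) -RintegralB//.
have Id := integrable_subr Igg Icg.
rewrite (le_trans (le_normr_Rintegral _ Id))//.
have Ib := integrable_addr Ie (integrable_circle_cst (K * (4 / N.+1%:R))).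
rewrite (le_trans (le_Rintegral _ (integrable_norm Id) Ib _))//.
  move=> x Cx /=; rewrite -mulrBl normrM (ger0_norm (fejer_ge0 _ _)).
  rewrite (le_trans (ler_wpM2r (fejer_ge0 _ _) (gK x Cx)))// mulrDl lerD2l.
  by rewrite -mulrA ler_wpM2l// mulrC fejer_decay.
rewrite RintegralD//; last exact: integrable_circle_cst.
rewrite -/(fejer_mean _ _ _) fejer_mean_cst// Rintegral_circle_cst.
have -> : e / (2 * pi) / 2 * (2 * pi) = e / 2 by rewrite mulrAC divfK ?gt_eqF.
rewrite [leRHS](splitr e) lerD2l (mulrA K) mulrAC ler_pdivrMr//.
by move: NK; lra.
Unshelve. all: by end_near. Qed.

(** The endpoint -pi, where continuity on the line says nothing about periodicity, is
    discarded as a null set in the dominated convergence theorem. *)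
Lemma fejer_form_cvg_continuous f g M : measurable_fun C f ->
  (forall x, C x -> `|f x| <= M) -> continuous g ->
  fejer_form N.+1 f g @[N --> \oo] --> 2 * pi * \int[mu]_(x in C) (f x * g x).
Proof.
move=> mf fM cg.
have If := integrable_bounded mf fM.
have [B gB] : exists B, forall x, C x -> `|g x| <= B.
  have cg' : {within `[- pi, pi], continuous g} by exact: continuous_subspaceT.
  have [B [_ gB]] := compact_bounded (continuous_compact cg' (@segment_compact _ _ _)).
  exists (B + 1) => x Cx; apply: (gB (B + 1)); first by rewrite ltrDl.
  by exists x => //; exact: subset_itv_co_cc.
have mg : measurable_fun C g.
  by apply: measurable_funTS; exact: continuous_measurable_fun.
have Ig := integrable_bounded mg gB.
have M0 : 0 <= M.
  apply: le_trans (fM (- pi) _) => //.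
  by rewrite /circle/= in_itv/= lexx gtrN ?pi_gt0.
have mN N : measurable_fun C (fun y => (f y * fejer_mean N.+1 g y)%:E).
  by have /integrableP[] := integrable_mul_fejer_mean N.+1 If Ig.
(* All points of the circle but -pi are interior. *)
have Cae (P : R -> Prop) : (forall y, - pi < y < pi -> P y) ->
    \forall y \ae mu, C y -> P y.
  move=> HP; exists [set (- pi : R)]; split => //; first exact: lebesgue_measure_set1.
  move=> y /= nP; apply: contrapT => /eqP y_pi; apply: nP => Cy; apply: HP.
  move: Cy; rewrite /circle/= in_itv/= => /andP[y1 ->]; rewrite andbT.
  by rewrite lt_neqAle y1 eq_sym y_pi.
have [] := @dominated_convergence _ _ R mu C measurable_circle
    (fun N y => (f y * fejer_mean N.+1 g y)%:E)
    (fun y => (f y * (g y * (2 * pi)))%:E) (fun=> (M * (B * (2 * pi)))%:E) mN.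
- apply/measurable_EFinP; apply: measurable_funM => //.
  by apply: measurable_funM.
- apply: Cae => y ypi; apply: cvg_EFin; first by near=> N.
  by apply: cvgMr; exact: fejer_mean_cvg gB (cg y).
- exact: integrable_circle_cst.
- apply: aeW => y N Cy; rewrite lee_fin normrM ler_pM// ?fM//.
  have IgK := integrable_mul_fejer N.+1 y Ig.
  rewrite (le_trans (le_normr_Rintegral _ IgK))//.
  rewrite -(fejer_mean_cst B y (ltn0Sn N)); apply: le_Rintegral => //.
  + exact: (integrable_norm IgK).
  + exact/integrable_mul_fejer/integrable_circle_cst.
  + move=> x Cx /=; rewrite normrM (ger0_norm (fejer_ge0 _ _)).
    by rewrite ler_wpM2r ?fejer_ge0 ?gB.
have Ifg : intg (fun x => f x * g x) by exact: integrable_mulb gB.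
have -> : (\int[mu]_(x in C) (f x * (g x * (2 * pi)))%:E =
    (2 * pi * \int[mu]_(x in C) (f x * g x))%:E)%E.
  rewrite -RintegralZl// /Rintegral fineK; last first.
    by apply: integrable_fin_num => //; exact: integrable_mulr.
  by apply: eq_integral => x _; rewrite mulrA mulrC.
by move=> _ _ /fine_cvg.
Unshelve. all: by end_near. Qed.

Lemma fejer_form_addl N f1 f2 g : intg f1 -> intg f2 -> intg g ->
  fejer_form N (fun x => f1 x + f2 x) g = fejer_form N f1 g + fejer_form N f2 g.
Proof.
move=> If1 If2 Ig; rewrite /fejer_form -RintegralD//; try exact: integrable_mul_fejer_mean.
by apply: eq_Rintegral => x _; rewrite mulrDl.
Qed.

Lemma fejer_form_addr N f g1 g2 : intg f -> intg g1 -> intg g2 ->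
  fejer_form N f (fun x => g1 x + g2 x) = fejer_form N f g1 + fejer_form N f g2.
Proof.
move=> If Ig1 Ig2; have Ig := integrable_addr Ig1 Ig2.
by rewrite (fejer_formC N If Ig) (fejer_formC N If Ig1) (fejer_formC N If Ig2) fejer_form_addl.
Qed.

(** For the remainders of an approximation: a separable bound makes the form and
    its expected limit small together, uniformly in N. *)
Lemma fejer_error f g (al be : R -> R) : measurable_fun C f -> intg f -> intg g ->
  intg al -> intg be ->
  (forall x y, C x -> C y -> `|f y * g x| <= al y + be x) ->
  forall N, (0 < N)%N ->
  `|fejer_form N f g - 2 * pi * \int[mu]_(x in C) (f x * g x)| <=
    4 * pi * (\int[mu]_(x in C) al x + \int[mu]_(x in C) be x).
Proof.
move=> mf If Ig Ial Ibe fg N N0.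
have Ifg : intg (fun x => f x * g x).
  apply: (@integrable_le _ (fun x => al x + be x)); last by move=> x Cx; exact: fg.
    by apply: measurable_funM => //; have /integrableP[/measurable_EFinP] := Ig.
  exact: integrable_addr.
have pi0 : 0 <= 2 * pi :> R by rewrite mulr_ge0 ?pi_ge0.
have := fejer_form_bound N0 If Ig Ial Ibe fg.
have : `|2 * pi * \int[mu]_(x in C) (f x * g x)| <=
    2 * pi * (\int[mu]_(x in C) al x + \int[mu]_(x in C) be x).
  rewrite normrM ger0_norm// ler_wpM2l// (le_trans (le_normr_Rintegral _ Ifg))//.
  rewrite -RintegralD//; apply: le_Rintegral => //.
  - exact: (integrable_norm Ifg).
  - exact: integrable_addr.
  - by move=> x Cx; exact: fg.
move=> h1 h2; rewrite (le_trans (ler_normB _ _))// (le_trans (lerD h2 h1))//.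
by rewrite le_eqVlt; apply/orP; left; apply/eqP; ring.
Qed.

(** For f bounded by M and r the remainder of g, take al = 0 and be = M |r|, which is
    small in L^1. *)
Lemma fejer_form_cvg_bounded f g M : measurable_fun C f ->
  (forall x, C x -> `|f x| <= M) -> intg g ->
  fejer_form N.+1 f g @[N --> \oo] --> 2 * pi * \int[mu]_(x in C) (f x * g x).
Proof.
move=> mf fM Ig; have If := integrable_bounded mf fM.
have M0 : 0 <= M.
  apply: le_trans (fM (- pi) _) => //.
  by rewrite /circle/= in_itv/= lexx gtrN ?pi_gt0.
have muC : (mu C < +oo)%E by rewrite [X in (X < _)%E]circle_measure ltry.
have [g_ [cg_ Ig_ g_g]] := approximation_continuous_integrable measurable_circle muC Ig.
apply/cvgrPdist_le => e e0.
pose d := e / 2 / (4 * pi * (M + 1)).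
have d0 : 0 < d by rewrite !divr_gt0// !mulr_gt0 ?pi_gt0// ltr_wpDl.
have [n gn] : exists n, \int[mu]_(x in C) `|g x - g_ n x| <= d.
  move/fine_cvg: g_g => /cvgrPdist_le /(_ d d0) [n _ /(_ n (leqnn n))] /=.
  rewrite sub0r normrN => gn; exists n; apply: le_trans gn.
  by rewrite /Rintegral; exact: ler_norm.
pose r x := g x - g_ n x.
have Ir : intg r by exact: integrable_subr.
have mg : measurable_fun C (g_ n).
  by apply: measurable_funTS; exact: continuous_measurable_fun.
have Inr : intg (fun x => M * `|r x|) by apply: integrable_mulr; exact: (integrable_norm Ir).
have err := fejer_error mf If Ir (integrable_circle_cst 0) Inr.
have {}err N : `|fejer_form N.+1 f r - 2 * pi * \int[mu]_(x in C) (f x * r x)| <= e / 2.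
  apply: le_trans (err _ N.+1 _) _ => //.
    by move=> x y Cx Cy; rewrite add0r normrM ler_wpM2r ?fM.
  rewrite Rintegral_circle_cst mul0r add0r RintegralZl//; last exact: (integrable_norm Ir).
  rewrite (@le_trans _ _ (4 * pi * (M * d)))// ?ler_wpM2l ?mulr_ge0 ?pi_ge0//.
  rewrite (@le_trans _ _ (d * (4 * pi * (M + 1))))//.
    have := pi_ge0 R; have := ltW d0; nra.
  by rewrite /d divfK// gt_eqF// !mulr_gt0 ?pi_gt0// ltr_wpDl.
have If_ : intg (fun x => f x * g_ n x).
  under eq_fun do rewrite mulrC; exact: integrable_mulb fM.
have If_r : intg (fun x => f x * r x).
  under eq_fun do rewrite mulrC; exact: integrable_mulb fM.
have gE : g = (fun x => g_ n x + r x) by apply/funext => x; rewrite /r addrC subrK.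
have /cvgrPdist_le /(_ (e / 2)) main := fejer_form_cvg_continuous mf fM (cg_ n).
near=> N; rewrite {1 2}gE fejer_form_addr//.
under eq_Rintegral do rewrite mulrDr.
rewrite RintegralD// mulrDr opprD addrACA [leRHS](splitr e).
apply: le_trans (ler_normD _ _) _; rewrite lerD//; last by rewrite distrC.
by near: N; apply: main; rewrite divr_gt0.
Unshelve. all: by end_near. Qed.

Lemma measurable_norm_powR p f : measurable_fun C f ->
  measurable_fun C (fun x => `|f x| `^ p).
Proof.
move=> mf; apply: (measurableT_comp (measurable_powR p)).
exact: (measurableT_comp (@normr_measurable _ setT)).
Qed.

(** Young's inequality for (a / d) (d b), with d chosen so that d^q / q = e. *)
Lemma young_eps (p q e : R) : 0 < p -> 0 < q -> p^-1 + q^-1 = 1 -> 0 < e ->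
  exists2 K, 0 < K & forall a b : R, 0 <= a -> 0 <= b -> a * b <= K * a `^ p + e * b `^ q.
Proof.
move=> p0 q0 pq e0; pose d := (e * q) `^ q^-1.
have eq0 : 0 < e * q by rewrite mulr_gt0.
have d0 : 0 < d by rewrite powR_gt0.
have dq : d `^ q = e * q by rewrite -powRrM mulVf ?gt_eqF// powRr1// ltW.
exists (d^-1 `^ p / p); first by rewrite divr_gt0// powR_gt0 ?invr_gt0.
move=> a b a0 b0; have d0' := ltW d0; have di : 0 <= d^-1 by rewrite invr_ge0.
have -> : a * b = (d^-1 * a) * (d * b) by rewrite mulrACA mulVf ?mul1r// gt_eqF.
apply: le_trans (conjugate_powR _ _ p0 q0 pq) _; try exact: mulr_ge0.
rewrite !powRM// dq; apply: lerD; first by rewrite mulrAC.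
by rewrite mulrAC mulfK ?gt_eqF.
Qed.

Lemma conj_exp_ge1 (p q : R) : 0 < p -> 0 < q -> p^-1 + q^-1 = 1 -> 1 <= p.
Proof.
move=> p0 q0 pq; rewrite -invf_le1// -pq lerDl invr_ge0; exact: ltW.
Qed.

Lemma integrable_mul_conj p q f g : 0 < p -> 0 < q -> p^-1 + q^-1 = 1 ->
  measurable_fun C f -> measurable_fun C g ->
  intg (fun x => `|f x| `^ p) -> intg (fun x => `|g x| `^ q) ->
  intg (fun x => f x * g x).
Proof.
move=> p0 q0 pq mf mg If Ig.
apply: (@integrable_le _ (fun x => p^-1 * `|f x| `^ p + q^-1 * `|g x| `^ q)).
- exact: measurable_funM.
- by apply: integrable_addr; exact: integrable_mulr.
- move=> x Cx; rewrite normrM ![_^-1 * _]mulrC.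
  exact: conjugate_powR.
Qed.

Lemma integrable_powR p f : 1 <= p -> measurable_fun C f ->
  intg (fun x => `|f x| `^ p) -> intg f.
Proof.
move=> p1 mf If; apply: (@integrable_le _ (fun x => 1 + `|f x| `^ p)) => //.
  by apply: integrable_addr => //; exact: integrable_circle_cst.
move=> x _; have [f1|/ltW f1] := leP `|f x| 1.
  by rewrite ler_wpDr// powR_ge0.
by rewrite ler_wpDl// le1r_powR.
Qed.

Lemma Lp_truncation (p : R) f : 0 < p -> measurable_fun C f -> intg (fun x => `|f x| `^ p) ->
  forall e : R, 0 < e -> exists M (r : R -> R), [/\ measurable_fun C r,
    forall x, `|f x - r x| <= M, intg (fun x => `|r x| `^ p) &
    \int[mu]_(x in C) (`|r x| `^ p) <= e].
Proof.
move=> p0 mf If e e0.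
(* The remainder is f where |f| exceeds n; the truncation is f - r. *)
pose r (n : nat) x := if `|f x| <= n%:R then 0 else f x.
have mr n : measurable_fun C (r n).
  apply: measurable_fun_if => //; last by apply: measurable_funS mf => // x [].
  by apply: measurable_fun_ler => //; exact: (measurableT_comp (@normr_measurable _ setT)).
have rf n x : `|r n x| <= `|f x| by rewrite /r; case: ifP; rewrite ?normr0.
have rfp n x : `|r n x| `^ p <= `|f x| `^ p.
  by apply: ge0_ler_powR; rewrite ?nnegrE// ltW.
have Ir n : intg (fun x => `|r n x| `^ p).
  apply: integrable_le If _; first exact: measurable_norm_powR.
  by move=> x _; rewrite ger0_norm ?powR_ge0.
have [] := @dominated_convergence _ _ R mu C measurable_circle
    (fun n x => (`|r n x| `^ p)%:E) (cst 0%E) (fun x => (`|f x| `^ p)%:E).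
- by move=> n; apply/measurable_EFinP; exact: measurable_norm_powR.
- exact: measurable_cst.
- apply: aeW => x Cx; apply: cvg_near_cst; near=> n.
  rewrite /r ifT ?normr0 ?powR0 ?gt_eqF//.
  by near: n; exact: nbhs_infty_ger.
- exact: If.
- by apply: aeW => x n Cx; rewrite lee_fin ger0_norm ?powR_ge0.
rewrite integral0 => _ _ /fine_cvg /cvgrPdist_le /(_ e e0) [n _ /(_ n (leqnn n))] /=.
rewrite sub0r normrN => rn; exists n%:R, (r n); split => //.
  by move=> x; rewrite /r; case: ifP => h; rewrite ?subr0// subrr normr0.
by apply: le_trans rn; rewrite /Rintegral; exact: ler_norm.
Unshelve. all: by end_near. Qed.

(** The error is controlled by K |r|^p + e |g|^q for the remainder r of a truncation of
    f: first e is fixed against the norm of g, which determines K, then the truncation is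
    chosen so that K |r|^p has small integral. *)
Theorem fejer_form_cvg p q f g : 0 < p -> 0 < q -> p^-1 + q^-1 = 1 ->
  measurable_fun C f -> measurable_fun C g ->
  intg (fun x => `|f x| `^ p) -> intg (fun x => `|g x| `^ q) ->
  fejer_form N.+1 f g @[N --> \oo] --> 2 * pi * \int[mu]_(x in C) (f x * g x).
Proof.
move=> p0 q0 pq mf mg Ifp Igq; apply/cvgrPdist_le => e e0.
have p1 := conj_exp_ge1 p0 q0 pq.
have q1 : 1 <= q by rewrite (conj_exp_ge1 q0 p0)// addrC.
have If := integrable_powR p1 mf Ifp; have Ig := integrable_powR q1 mg Igq.
have pi0 : 0 < 4 * pi :> R by rewrite mulr_gt0 ?pi_gt0.
pose e1 := e / 4 / (4 * pi); have e10 : 0 < e1 by rewrite !divr_gt0.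
pose B := \int[mu]_(x in C) (`|g x| `^ q).
have B0 : 0 <= B by apply: Rintegral_ge0 => x _; exact: powR_ge0.
have B1 : 0 < B + 1 by rewrite ltr_wpDl.
have [K K0 yK] := young_eps p0 q0 pq (divr_gt0 e10 B1).
have [M [r [mr frM Irp rK]]] := Lp_truncation p0 mf Ifp (divr_gt0 e10 K0).
have Ir := integrable_powR p1 mr Irp.
have mh : measurable_fun C (fun x => f x - r x) by exact: measurable_funB.
have Ih := integrable_subr If Ir.
have err N : `|fejer_form N.+1 r g - 2 * pi * \int[mu]_(x in C) (r x * g x)| <= e / 2.
  have Ia := integrable_mulr K Irp; have Ib := integrable_mulr (e1 / (B + 1)) Igq.
  apply: le_trans (fejer_error mr Ir Ig Ia Ib _ _) _ => //.
    by move=> x y _ _; rewrite normrM; exact: yK.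
  rewrite !RintegralZl// -/B.
  have -> : e / 2 = 4 * pi * (e1 + e1).
    by rewrite mulrDr [4 * pi * e1]mulrC divfK ?gt_eqF//; lra.
  rewrite ler_wpM2l ?(ltW pi0)// lerD//; first by rewrite mulrC -ler_pdivlMr.
  by rewrite mulrAC ler_pdivrMr// ler_wpM2l ?lerDl ?ltW.
have Ihg : intg (fun x => (f x - r x) * g x).
  under eq_fun do rewrite mulrC; exact: integrable_mulb (fun x _ => frM x).
have Irg := integrable_mul_conj p0 q0 pq mr mg Irp Igq.
have fE : f = (fun x => (f x - r x) + r x) by apply/funext => x; rewrite subrK.
have /cvgrPdist_le /(_ (e / 2)) main := fejer_form_cvg_bounded mh (fun x _ => frM x) Ig.
near=> N; rewrite fE fejer_form_addl//.
under eq_Rintegral do rewrite mulrDl.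
rewrite RintegralD// mulrDr opprD addrACA [leRHS](splitr e).
apply: le_trans (ler_normD _ _) _; rewrite lerD//; last by rewrite distrC.
by near: N; apply: main; rewrite divr_gt0.
Unshelve. all: by end_near. Qed.
End real_circle.

(** * Complex functions of class L^p on the circle *)

Section complex_circle.
Context {R : realType}.
Implicit Types (f g : R -> R[i]) (p q : R) (z w : R[i]).
Local Notation mu := (@lebesgue_measure R).
Local Notation C := (@circle R).
Local Notation intg f := (mu.-integrable C (EFin \o f)).
Local Notation Re := complex.Re.
Local Notation Im := complex.Im.
Hint Extern 0 (measurable _) => solve [exact: measurable_circle] : core.

Lemma cmodE z : cmod z = Num.sqrt (Re z ^+ 2 + Im z ^+ 2).
Proof. by rewrite /cmod normc_def. Qed.

Lemma cmod_ge0 z : 0 <= cmod z.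
Proof. by rewrite cmodE sqrtr_ge0. Qed.

Lemma norm_cmod z : `|z| = (cmod z)%:C.
Proof. by rewrite cmodE normc_def. Qed.

Lemma sqr_cmod z : cmod z ^+ 2 = Re z ^+ 2 + Im z ^+ 2.
Proof. by rewrite cmodE sqr_sqrtr// addr_ge0// sqr_ge0. Qed.

Lemma cmodM z w : cmod (z * w) = cmod z * cmod w.
Proof. by apply: complexI; rewrite -norm_cmod normrM !norm_cmod rmorphM. Qed.

Lemma cmod1 : cmod (1 : R[i]) = 1.
Proof. by apply: complexI; rewrite -norm_cmod normr1. Qed.

Lemma cmodX z n : cmod (z ^+ n) = cmod z ^+ n.
Proof. by elim: n => [|n IH]; rewrite ?expr0 ?cmod1// !exprS cmodM IH. Qed.

Lemma conjE z : z^* = conjc z.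
Proof. by []. Qed.

Lemma cmodJ z : cmod z^* = cmod z.
Proof. by apply: complexI; rewrite conjE -!norm_cmod normcJ. Qed.

Lemma cmodB_le z w : cmod (z - w) <= cmod z + cmod w.
Proof. by rewrite -lecR rmorphD/= -!norm_cmod ler_normB. Qed.

Lemma cmod_eq0 z : cmod z = 0 -> z = 0.
Proof. by move=> z0; apply/normr0_eq0; rewrite norm_cmod z0. Qed.

Lemma Re_le_cmod z : `|Re z| <= cmod z.
Proof. by rewrite cmodE -sqrtr_sqr ler_wsqrtr// lerDl sqr_ge0. Qed.

Lemma Im_le_cmod z : `|Im z| <= cmod z.
Proof. by rewrite cmodE -sqrtr_sqr ler_wsqrtr// lerDr sqr_ge0. Qed.

Lemma ReM z w : Re (z * w) = Re z * Re w - Im z * Im w.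
Proof. by case: z w => [a b] [c d]. Qed.

Lemma ImM z w : Im (z * w) = Re z * Im w + Im z * Re w.
Proof. by case: z w => [a b] [c d]. Qed.

Definition measurable_complex f :=
  measurable_fun C (fun t => Re (f t)) /\ measurable_fun C (fun t => Im (f t)).

(** The conditions of [in_Lp] without periodicity, and with finiteness of the norm put as
    integrability; see [in_LpP]. *)
Definition Lp_circle p f :=
  measurable_complex f /\ intg (fun t => cmod (f t) `^ p).

Lemma measurable_cmod f : measurable_complex f -> measurable_fun C (fun t => cmod (f t)).
Proof.
move=> [mr mi]; under eq_fun do rewrite cmodE.
apply: (measurableT_comp (continuous_measurable_fun (@sqrt_continuous R))).
by apply: measurable_funD; exact: measurable_funX.
Qed.

Lemma measurable_cmod_powR p f : measurable_complex f ->
  measurable_fun C (fun t => cmod (f t) `^ p).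
Proof.
by move=> mf; apply: (measurableT_comp (measurable_powR p)); exact: measurable_cmod.
Qed.

Lemma measurable_complexM f g : measurable_complex f -> measurable_complex g ->
  measurable_complex (fun t => f t * g t).
Proof.
move=> [fr fi] [gr gi]; split.
  by under eq_fun do rewrite ReM; apply: measurable_funB; exact: measurable_funM.
by under eq_fun do rewrite ImM; apply: measurable_funD; exact: measurable_funM.
Qed.

Lemma measurable_complexB f g : measurable_complex f -> measurable_complex g ->
  measurable_complex (fun t => f t - g t).
Proof.
move=> [fr fi] [gr gi]; split.
  by under eq_fun do rewrite raddfB; exact: measurable_funB.
by under eq_fun do rewrite raddfB; exact: measurable_funB.
Qed.

Lemma measurable_complexJ f : measurable_complex f ->
  measurable_complex (fun t => (f t)^*).
Proof.
have RJ z : Re z^* = Re z by case: z.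
have IJ z : Im z^* = - Im z by case: z.
move=> [fr fi]; split; first by under eq_fun do rewrite RJ.
by under eq_fun do rewrite IJ; exact: measurable_funN.
Qed.

Lemma Lp_circleJ p f : Lp_circle p f -> Lp_circle p (fun t => (f t)^*).
Proof.
move=> [mf If]; split; first exact: measurable_complexJ.
by under eq_fun do rewrite cmodJ.
Qed.

(** Uses |a + b|^p <= (2 max(|a|, |b|))^p <= 2^p (|a|^p + |b|^p), in place of
    the triangle inequality for the norm. *)
Lemma Lp_circleB p f g : 0 < p -> Lp_circle p f -> Lp_circle p g ->
  Lp_circle p (fun t => f t - g t).
Proof.
move=> p0 [mf If] [mg Ig]; have mfg := measurable_complexB mf mg.
split=> //.
apply: (@integrable_le _ _ (fun t => 2 `^ p * (cmod (f t) `^ p + cmod (g t) `^ p))).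
- exact: measurable_cmod_powR.
- by apply: integrable_mulr; exact: integrable_addr.
- move=> t _; rewrite ger0_norm ?powR_ge0//.
  have fg := cmodB_le (f t) (g t).
  set a := cmod (f t) in fg *; set b := cmod (g t) in fg *.
  have [a0 b0] : 0 <= a /\ 0 <= b by rewrite !cmod_ge0.
  apply: (@le_trans _ _ ((2 * Num.max a b) `^ p)).
    apply: ge0_ler_powR; rewrite ?nnegrE ?cmod_ge0 ?(ltW p0)//.
      by rewrite mulr_ge0// le_max a0.
    by apply: le_trans fg _; rewrite mulr_natl mulr2n lerD// le_max lexx ?orbT.
  rewrite powRM ?le_max ?a0// ler_wpM2l ?powR_ge0//.
  by case: (leP a b) => _; rewrite ?lerDl ?lerDr powR_ge0.
Qed.

Lemma Lp_circle_Re p f : 0 < p -> Lp_circle p f -> intg (fun t => `|Re (f t)| `^ p).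
Proof.
move=> p0 [[mr mi] If]; apply: integrable_le If _; first exact: measurable_norm_powR.
move=> t _; rewrite ger0_norm ?powR_ge0//.
by apply: ge0_ler_powR; rewrite ?nnegrE ?cmod_ge0 ?(ltW p0)// Re_le_cmod.
Qed.

Lemma Lp_circle_Im p f : 0 < p -> Lp_circle p f -> intg (fun t => `|Im (f t)| `^ p).
Proof.
move=> p0 [[mr mi] If]; apply: integrable_le If _; first exact: measurable_norm_powR.
move=> t _; rewrite ger0_norm ?powR_ge0//.
by apply: ge0_ler_powR; rewrite ?nnegrE ?cmod_ge0 ?(ltW p0)// Im_le_cmod.
Qed.

Lemma Lp_circle_integrable p f : 1 <= p -> Lp_circle p f ->
  intg (fun t => Re (f t)) /\ intg (fun t => Im (f t)).
Proof.
move=> p1 Lf; have p0 : 0 < p by exact: lt_le_trans p1.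
have [[mr mi] _] := Lf; split; apply: (integrable_powR p1) => //.
  exact: Lp_circle_Re.
exact: Lp_circle_Im.
Qed.

Lemma cos_coefN (m : int) (h : R -> R) : cos_coef (- m) h = cos_coef m h.
Proof. by apply: eq_Rintegral => x _; rewrite rmorphN/= mulNr cosN. Qed.

Lemma sin_coefN (m : int) (h : R -> R) : intg h -> sin_coef (- m) h = - sin_coef m h.
Proof.
move=> Ih; rewrite -[RHS]mulN1r /sin_coef -RintegralZl//; last exact: integrable_sin.
by apply: eq_Rintegral => x _; rewrite rmorphN/= mulNr sinN mulrN mulN1r.
Qed.

Lemma fourierE f (n : int) : intg (fun t => Re (f t)) -> intg (fun t => Im (f t)) ->
  fourier f n = ((2 * pi)^-1)%:C *
    ((cos_coef n (fun t => Re (f t)) + sin_coef n (fun t => Im (f t))) +i*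
     (cos_coef n (fun t => Im (f t)) - sin_coef n (fun t => Re (f t)))).
Proof.
move=> Ir Ii; rewrite /fourier; congr (_ * _); congr (_ +i* _).
  rewrite -RintegralD//; [|exact: integrable_cos|exact: integrable_sin].
  apply: eq_Rintegral => t _; rewrite ReM /expi/= cosN sinN; lra.
rewrite -RintegralB//; [|exact: integrable_cos|exact: integrable_sin].
by apply: eq_Rintegral => t _; rewrite ImM /expi/= cosN sinN; lra.
Qed.

Lemma fourier_ge0P f (n : int) : intg (fun t => Re (f t)) -> intg (fun t => Im (f t)) ->
  0 <= fourier f n <->
  0 <= cos_coef n (fun t => Re (f t)) + sin_coef n (fun t => Im (f t)) /\
  cos_coef n (fun t => Im (f t)) = sin_coef n (fun t => Re (f t)).
Proof.
move=> Ir Ii; rewrite fourierE//.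
have pi2 : 0 < (2 * pi)^-1 :> R by rewrite invr_gt0 mulr_gt0 ?pi_gt0.
rewrite pmulr_rge0 ?ltcR// lecE/=; split.
  by move=> /andP[/eqP/eqP] ; rewrite subr_eq0 => /eqP -> ->.
by move=> [-> ->]; rewrite subrr eqxx.
Qed.

(** * Products of functions with nonnegative coefficients *)

(** Compare the conditions of [fourier_ge0P] at n and at -n: cosine coefficients are even
    in n and sine coefficients odd. *)
Lemma fourier_ge0_coefs f : intg (fun t => Re (f t)) -> intg (fun t => Im (f t)) ->
  (forall n, 0 <= fourier f n) -> forall n,
  [/\ cos_coef n (fun t => Im (f t)) = 0, sin_coef n (fun t => Re (f t)) = 0 &
      `|sin_coef n (fun t => Im (f t))| <= cos_coef n (fun t => Re (f t))].
Proof.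
move=> Ir Ii f0 n.
have [fn1 fn2] := (fourier_ge0P n Ir Ii).1 (f0 n).
have [] := (fourier_ge0P (- n) Ir Ii).1 (f0 (- n)).
rewrite !cos_coefN !sin_coefN// => fm1 fm2; split; [lra|lra|].
by rewrite ler_norml; apply/andP; split; lra.
Qed.

(** With f = u + i v and g = u' + i v', the previous lemma kills the terms in v u' and
    u v', so the imaginary part vanishes.  In the Fejer form of u u' - v v' each frequency
    contributes cos_coef u * cos_coef u' - sin_coef v * sin_coef v', where the cosine
    coefficients dominate the sine coefficients. *)
Lemma Cintegral_mul_ge0 p q f g : 0 < p -> 0 < q -> p^-1 + q^-1 = 1 ->
  Lp_circle p f -> Lp_circle q g ->
  (forall n, 0 <= fourier f n) -> (forall n, 0 <= fourier g n) ->
  0 <= Cintegral C (fun t => f t * g t).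
Proof.
move=> p0 q0 pq Lf Lg f0 g0.
have p1 := conj_exp_ge1 p0 q0 pq.
have q1 : 1 <= q by rewrite (conj_exp_ge1 q0 p0)// addrC.
have [Ifr Ifi] := Lp_circle_integrable p1 Lf.
have [Igr Igi] := Lp_circle_integrable q1 Lg.
have Pfr := Lp_circle_Re p0 Lf; have Pfi := Lp_circle_Im p0 Lf.
have Pgr := Lp_circle_Re q0 Lg; have Pgi := Lp_circle_Im q0 Lg.
have [[mfr mfi] _] := Lf; have [[mgr mgi] _] := Lg.
have fc := fourier_ge0_coefs Ifr Ifi f0; have gc := fourier_ge0_coefs Igr Igi g0.
have pi0 : 0 < 2 * pi :> R by rewrite mulr_gt0 ?pi_gt0.
have rr := fejer_form_cvg p0 q0 pq mfr mgr Pfr Pgr.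
have ii := fejer_form_cvg p0 q0 pq mfi mgi Pfi Pgi.
have ri := fejer_form_cvg p0 q0 pq mfr mgi Pfr Pgi.
have ir := fejer_form_cvg p0 q0 pq mfi mgr Pfi Pgr.
have Jrr := integrable_mul_conj p0 q0 pq mfr mgr Pfr Pgr.
have Jii := integrable_mul_conj p0 q0 pq mfi mgi Pfi Pgi.
have Jri := integrable_mul_conj p0 q0 pq mfr mgi Pfr Pgi.
have Jir := integrable_mul_conj p0 q0 pq mfi mgr Pfi Pgr.
have form0 (u v : R -> R) : intg u -> intg v ->
    (forall n, cos_coef n u * cos_coef n v + sin_coef n u * sin_coef n v = 0) ->
    forall l, fejer_form N.+1 u v @[N --> \oo] --> 2 * pi * l -> l = 0.
  move=> Iu Iv uv0 l ul; apply: (mulfI (lt0r_neq0 pi0)); rewrite mulr0.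
  apply: (cvg_unique _ ul) => //.
  rewrite (_ : (fun N => _) = cst 0); first exact: cvg_cst.
  apply/funext => N /=; rewrite fejer_formE// big1// => k _.
  by rewrite uv0 mulr0.
rewrite lecE /Cintegral/=; apply/andP; split.
  under eq_Rintegral do rewrite ImM.
  rewrite RintegralD//.
  rewrite (form0 _ _ Ifr Igi _ _ ri); last first.
    by move=> n; have [_ -> _] := fc n; have [-> _ _] := gc n; rewrite mulr0 mul0r addr0.
  rewrite (form0 _ _ Ifi Igr _ _ ir) ?addr0//.
  by move=> n; have [-> _ _] := fc n; have [_ -> _] := gc n; rewrite mulr0 mul0r addr0.
under eq_Rintegral do rewrite ReM.
rewrite RintegralB// -(pmulr_rge0 _ pi0) mulrBr.
apply: (cvgr_to_ge (cvgB rr ii)).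
near=> N; rewrite !fctE !fejer_formE// -sumrB sumr_ge0// => k _.
rewrite -mulrBr mulr_ge0 ?invr_ge0//.
have [-> -> fk] := fc (freq k); have [-> -> gk] := gc (freq k).
rewrite !mulr0 addr0 add0r subr_ge0 (le_trans (ler_norm _))// normrM.
exact: ler_pM.
Unshelve. all: by end_near. Qed.

Lemma expiD (s t : R) : expi (s + t) = expi s * expi t.
Proof.
by apply/eqP; rewrite eq_complex /expi/= cosD sinD eqxx/= addrC.
Qed.

Lemma cmod_expi (t : R) : cmod (expi t) = 1.
Proof. by rewrite cmodE cos2Dsin2 sqrtr1. Qed.

(** Multiplying g by e^(-int) shifts its coefficients by n and turns the n-th coefficient
    of f g into a mean. *)
Lemma fourier_mul_ge0 p q f g : 0 < p -> 0 < q -> p^-1 + q^-1 = 1 ->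
  Lp_circle p f -> Lp_circle q g ->
  (forall n, 0 <= fourier f n) -> (forall n, 0 <= fourier g n) ->
  forall n, 0 <= fourier (fun t => f t * g t) n.
Proof.
move=> p0 q0 pq Lf [mg Ig] f0 g0 n.
have pi2 : 0 < (2 * pi)^-1 :> R by rewrite invr_gt0 mulr_gt0 ?pi_gt0.
rewrite /fourier pmulr_rge0 ?ltcR//.
pose h t := g t * expi (- (n%:~R * t)).
rewrite (_ : (fun t => _) = (fun t => f t * h t)); last first.
  by apply/funext => t; rewrite mulrA.
apply: Cintegral_mul_ge0 pq _ _ _ _ => //.
- split.
    apply: measurable_complexM => //; rewrite /expi; split => /=.
      under eq_fun do rewrite cosN.
      by apply: measurable_funTS; apply: continuous_measurable_fun; exact: continuous_cos_scale.
    under eq_fun do rewrite sinN.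
    apply: measurable_funN.
    by apply: measurable_funTS; apply: continuous_measurable_fun; exact: continuous_sin_scale.
  by under eq_fun do rewrite cmodM cmod_expi mulr1.
- move=> m; rewrite (_ : fourier h m = fourier g (n + m))//.
  congr (_ * Cintegral _ _); apply/funext => t.
  by rewrite /h -mulrA -expiD rmorphD/= mulrDl opprD.
Qed.

Lemma cos_coefZ n (r : R) (h : R -> R) : intg h ->
  cos_coef n (fun t => r * h t) = r * cos_coef n h.
Proof.
move=> Ih; rewrite /cos_coef -RintegralZl//; last exact: integrable_cos.
by apply: eq_Rintegral => t _; rewrite mulrA.
Qed.

Lemma sin_coefZ n (r : R) (h : R -> R) : intg h ->
  sin_coef n (fun t => r * h t) = r * sin_coef n h.
Proof.
move=> Ih; rewrite /sin_coef -RintegralZl//; last exact: integrable_sin.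
by apply: eq_Rintegral => t _; rewrite mulrA.
Qed.

Lemma fourier_conj_ge0 f n : intg (fun t => Re (f t)) -> intg (fun t => Im (f t)) ->
  (forall n, 0 <= fourier f n) -> 0 <= fourier (fun t => (f t)^*) n.
Proof.
move=> Ir Ii f0; have [ci sr si] := fourier_ge0_coefs Ir Ii f0 n.
have RJ t : Re (f t)^* = Re (f t) by case: (f t).
have IJ t : Im (f t)^* = -1 * Im (f t) by rewrite mulN1r; case: (f t).
have IiJ : intg (fun t => Im (f t)^*).
  by under eq_fun do rewrite IJ; exact: integrable_mulr.
have IrJ : intg (fun t => Re (f t)^*) by under eq_fun do rewrite RJ.
apply/(fourier_ge0P n IrJ IiJ).
under eq_fun do rewrite RJ; rewrite sr.
have -> : (fun t => Im (f t)^*) = (fun t => -1 * Im (f t)) by apply/funext.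
rewrite cos_coefZ// sin_coefZ// ci mulr0; split => //.
by move: si; rewrite ler_norml => /andP[]; lra.
Qed.

Lemma cos_coefB n (h k : R -> R) : intg h -> intg k ->
  cos_coef n (fun t => h t - k t) = cos_coef n h - cos_coef n k.
Proof.
move=> Ih Ik; rewrite /cos_coef -RintegralB//; try exact: integrable_cos.
by apply: eq_Rintegral => t _; rewrite mulrBl.
Qed.

Lemma sin_coefB n (h k : R -> R) : intg h -> intg k ->
  sin_coef n (fun t => h t - k t) = sin_coef n h - sin_coef n k.
Proof.
move=> Ih Ik; rewrite /sin_coef -RintegralB//; try exact: integrable_sin.
by apply: eq_Rintegral => t _; rewrite mulrBl.
Qed.

Lemma fourierB f g n :
  intg (fun t => Re (f t)) -> intg (fun t => Im (f t)) ->
  intg (fun t => Re (g t)) -> intg (fun t => Im (g t)) ->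
  fourier (fun t => f t - g t) n = fourier f n - fourier g n.
Proof.
move=> fr fi gr gi.
have RB : (fun t => Re (f t - g t)) = (fun t => Re (f t) - Re (g t)).
  by apply/funext => t; rewrite raddfB.
have IB : (fun t => Im (f t - g t)) = (fun t => Im (f t) - Im (g t)).
  by apply/funext => t; rewrite raddfB.
rewrite !fourierE// ?RB ?IB; try exact: integrable_subr.
rewrite !cos_coefB// !sin_coefB// -mulrBr; congr (_ * _).
by apply/eqP; rewrite eq_complex/=; apply/andP; split; apply/eqP; ring.
Qed.

Lemma fourier1_ge0 n : 0 <= fourier (fun=> 1 : R[i]) n.
Proof.
have I1 : intg (fun=> Re (1 : R[i])) by exact: integrable_circle_cst.
have I0 : intg (fun=> Im (1 : R[i])) by exact: integrable_circle_cst.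
apply/fourier_ge0P => //; rewrite /cos_coef /sin_coef/=.
under eq_Rintegral do rewrite mul1r.
under [X in _ + X]eq_Rintegral do rewrite mul0r.
under [X in _ /\ X = _]eq_Rintegral do rewrite mul0r.
under [X in _ /\ _ = X]eq_Rintegral do rewrite mul1r.
rewrite Rintegral_circle_cos Rintegral_circle_sin Rintegral_circle_cst !mul0r addr0.
by rewrite !mulr_ge0// pi_ge0.
Qed.

(** * Norms and Young's inequality with its equality case *)

Lemma in_LpP p f : 0 < p -> in_Lp p f <-> periodic f (2 * pi) /\ Lp_circle p f.
Proof.
move=> p0; have pi2 : 0 < (2 * pi)^-1 :> R by rewrite invr_gt0 mulr_gt0 ?pi_gt0.
have E : measurable_complex f -> (Lp_norm p f < +oo)%E <-> intg (fun t => cmod (f t) `^ p).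
  move=> mf; have mp := measurable_cmod_powR p mf.
  have E : (\int[mu]_(t in C) (cmod (f t) `^ p)%:E =
            \int[mu]_(t in C) `|(cmod (f t) `^ p)%:E|)%E.
    by apply: eq_integral => t _; rewrite gee0_abs// lee_fin powR_ge0.
  rewrite /Lp_norm; split=> [|If].
    move=> /lty_poweRy; rewrite invr_eq0 gt_eqF// => /(_ isT).
    rewrite E => h; apply/integrableP; split; first exact/measurable_EFinP.
    move: h; rewrite -E; case: (integral _ _ _) => //.
    - by move=> r _; exact: ltry.
    - by rewrite gt0_muley ?lte_fin.
  apply: poweR_lty; rewrite lte_mul_pinfty ?lee_fin ?ltW//.
  by have /integrableP[_] := If; rewrite E.
split=> [[pf mr mi] /E If|[pf [[mr mi] If]]]; first by split=> //; split=> //; exact: If.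
by split=> //; apply/E.
Qed.

Lemma Lp_normE p f : Lp_circle p f ->
  Lp_norm p f = (((2 * pi)^-1 * \int[mu]_(t in C) cmod (f t) `^ p) `^ p^-1)%:E.
Proof.
move=> [_ If]; rewrite /Lp_norm -poweR_EFin EFinM /Rintegral fineK//.
exact: integrable_fin_num.
Qed.

Lemma Lp_norm_le p f g : 0 < p -> Lp_circle p f -> Lp_circle p g ->
  (Lp_norm p f <= Lp_norm p g)%E =
  (\int[mu]_(t in C) cmod (f t) `^ p <= \int[mu]_(t in C) cmod (g t) `^ p).
Proof.
move=> p0 Lf Lg; have pi2 : 0 < (2 * pi)^-1 :> R by rewrite invr_gt0 mulr_gt0 ?pi_gt0.
have If0 h : 0 <= \int[mu]_(t in C) cmod (h t) `^ p.
  by apply: Rintegral_ge0 => t _; exact: powR_ge0.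
rewrite !Lp_normE// lee_fin -[RHS](ler_pM2l pi2).
apply/idP/idP; last first.
  by apply: ge0_ler_powR; rewrite ?nnegrE ?invr_ge0 ?mulr_ge0// ltW.
rewrite !leNgt; apply: contra; apply: gt0_ltr_powR; rewrite ?nnegrE ?invr_gt0//.
  by rewrite mulr_ge0// ltW.
by rewrite mulr_ge0// ltW.
Qed.

(** Young's inequality for the integer exponent k + 2, with a quadratic remainder that
    settles the case of equality. *)
Lemma young_expn (k : nat) (b c : R) : 0 <= b -> 0 <= c ->
  c ^+ k * (b - c) ^+ 2 <=
    b ^+ k.+2 + k.+1%:R * c ^+ k.+2 - k.+2%:R * c ^+ k.+1 * b.
Proof.
move=> b0 c0; elim: k => [|k IH].
  by rewrite !expr0 !expr1 !expr2; lra.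
have -> : b ^+ k.+3 + k.+2%:R * c ^+ k.+3 - k.+3%:R * c ^+ k.+2 * b =
    b * (b ^+ k.+2 + k.+1%:R * c ^+ k.+2 - k.+2%:R * c ^+ k.+1 * b) +
    k.+2%:R * (c ^+ k.+1 * (b - c) ^+ 2).
  by rewrite !exprS -(natr1 k.+2) -(natr1 k.+1); ring.
have E0 : 0 <= c ^+ k.+1 * (b - c) ^+ 2 by rewrite mulr_ge0 ?sqr_ge0 ?exprn_ge0.
rewrite ler_wpDl//.
  by rewrite mulr_ge0// (le_trans _ IH)// mulr_ge0 ?sqr_ge0 ?exprn_ge0.
by rewrite ler_peMl// ler1n.
Qed.

Lemma sqr_cmodB z w : cmod (z - w) ^+ 2 = cmod z ^+ 2 + cmod w ^+ 2 - 2 * Re (z * w^*).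
Proof. by rewrite conjE !sqr_cmod; case: z w => [a b] [c d] /=; ring. Qed.

Lemma ReMJ_le z w : Re (z * w^*) <= cmod z * cmod w.
Proof. by rewrite (le_trans (ler_norm _))// -(cmodJ w) -cmodM Re_le_cmod. Qed.

Lemma mulJ_cmod z : z^* * z = ((cmod z) ^+ 2)%:C.
Proof. by rewrite conjE mulrC -sqr_normc norm_cmod rmorphXn. Qed.

Lemma conjc_realM (r : R) z : (r%:C * z)^* = r%:C * z^*.
Proof.
by rewrite !conjE; case: z => x y; apply/eqP; rewrite eq_complex/=; apply/andP; split; apply/eqP; ring.
Qed.

(** * The extremal function and its minimality *)

Definition conj_prod (a b : nat) f t : R[i] := (f t)^* ^+ a * f t ^+ b.

Lemma cmod_conj_prod a b f t : cmod (conj_prod a b f t) = cmod (f t) ^+ (a + b).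
Proof. by rewrite cmodM !cmodX cmodJ exprD. Qed.

Section even_exponent.
Context (j : nat) (j1 : (1 < j)%N).
Local Notation n := (2 * j)%N.
Local Notation m := (2 * j - 1)%N.
Local Notation p := (n%:R / m%:R : R).
Local Notation phi h := (conj_prod (j - 1) j h).

Lemma double_predn : n = m.+1. Proof. lia. Qed.

Lemma exponents_gt0 : 0 < m%:R :> R /\ 0 < n%:R :> R.
Proof. by rewrite !ltr0n; lia. Qed.

Lemma conj_exponent_gt0 : 0 < p.
Proof. by have [m0 n0] := exponents_gt0; rewrite divr_gt0. Qed.

Lemma conj_exponents : p^-1 + n%:R^-1 = 1.
Proof.
have [m0 n0] := exponents_gt0.
by rewrite invf_div -[X in _ + X]mul1r -mulrDl natr1 -double_predn divff// gt_eqF.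
Qed.

Lemma powR_root_exp (a : R) : 0 <= a ->
  let c := a `^ m%:R^-1 in [/\ 0 <= c, a = c ^+ m & a `^ p = c ^+ n].
Proof.
move=> a0 c; have [m0 n0] := exponents_gt0.
have c0 : 0 <= c by exact: powR_ge0.
split=> //; rewrite -powR_mulrn// /c -powRrM.
  by rewrite mulVf ?gt_eqF// powRr1.
by rewrite mulrC.
Qed.

Lemma young_cmod z w : Re (z * w^*) <= cmod z `^ p / p + cmod w ^+ n / n%:R.
Proof.
apply: le_trans (ReMJ_le z w) _; have [m0 n0] := exponents_gt0.
have -> : cmod w ^+ n = cmod w `^ n%:R by rewrite powR_mulrn ?cmod_ge0.
by apply: conjugate_powR; rewrite ?cmod_ge0 ?conj_exponent_gt0 ?conj_exponents.
Qed.

Lemma cmod_phi_powR f t : cmod (phi f t) `^ p = cmod (f t) ^+ n.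
Proof.
have [m0 n0] := exponents_gt0; have h0 := cmod_ge0 (f t).
rewrite cmod_conj_prod -!powR_mulrn// -powRrM; congr (_ `^ _).
rewrite (_ : (j - 1 + j)%N = m); last by lia.
by rewrite mulrC divfK// gt_eqF.
Qed.

Lemma Re_phiJ f t : Re (phi f t * (f t)^*) = cmod (f t) ^+ n.
Proof.
rewrite /conj_prod mulrAC -exprSr (_ : (j - 1).+1 = j); last by lia.
by rewrite -exprMn mulJ_cmod -rmorphXn/= -exprM.
Qed.

Lemma phi_scale f t : phi f t = ((cmod (f t) ^+ 2) ^+ (j - 1))%:C * f t.
Proof.
rewrite rmorphXn/= -mulJ_cmod exprMn -mulrA -exprSr.
by rewrite (_ : (j - 1).+1 = j)//; lia.
Qed.

(** Put |z| = c^m and b = |f t|.  The remainder of [young_expn] vanishes, so b = c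
    (if c = 0 then b^n <= 0) and Re (z conj (f t)) = b^n = |z| |f t|.  Hence |z|^2 = |phi|^2 = Re (z conj phi), and
    the expansion of |z - phi|^2 vanishes.  Working with this square avoids dividing by
    f t, which may be zero. *)
Lemma young_cmod_eq f t z :
  cmod z `^ p / p + cmod (f t) ^+ n / n%:R <= Re (z * (f t)^*) -> z = phi f t.
Proof.
move=> le_Re; have [m0 n0] := exponents_gt0.
set w := f t in le_Re *; set b := cmod w in le_Re *.
have b0 : 0 <= b by exact: cmod_ge0.
have [] := powR_root_exp (cmod_ge0 z); set c := _ `^ _ => c0 zc zp.
have le_prod := ReMJ_le z w; rewrite -/b in le_prod.
have : m%:R * c ^+ n + b ^+ n <= n%:R * c ^+ m * b.
  rewrite -zc -mulrA [X in _ <= X]mulrC -ler_pdivrMr// mulrDl.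
  apply: le_trans le_prod; apply: le_trans le_Re.
  by rewrite zp invf_div mulrA [m%:R * _]mulrC.
have [k kE] : exists k, n = k.+2 by exists (n - 2)%N; lia.
have mk : m = k.+1 by lia.
rewrite mk kE => up; have := young_expn k b0 c0.
have low : 0 <= c ^+ k * (b - c) ^+ 2 by rewrite mulr_ge0 ?sqr_ge0 ?exprn_ge0.
move=> mid; have /eqP : c ^+ k * (b - c) ^+ 2 = 0 by lra.
rewrite mulf_eq0 expf_eq0 sqrf_eq0 subr_eq0 => bc.
have {bc} bc : b = c.
  case/orP: bc => [/andP[_ /eqP c00]|/eqP//].
  move: up; rewrite c00 !expr0n/= !mulr0 mul0r add0r => bk.
  have : b ^+ k.+2 == 0 by rewrite eq_le bk exprn_ge0.
  by rewrite expf_eq0 => /eqP.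
have zb : cmod z = b ^+ m by rewrite zc bc.
have Rezw : Re (z * w^*) = b ^+ n.
  apply/le_anti/andP; split.
    by apply: le_trans le_prod _; rewrite zb -exprSr -double_predn.
  by apply: le_trans le_Re; rewrite zp -bc -mulrDr conj_exponents mulr1.
have Rezphi : Re (z * (phi f t)^*) = b ^+ m ^+ 2.
  have -> : z * (phi f t)^* = ((b ^+ 2) ^+ (j - 1))%:C * (z * w^*).
    by rewrite phi_scale -/w -/b conjc_realM mulrCA.
  rewrite ReM/= mul0r subr0 Rezw -!exprM -exprD; congr (_ ^+ _); lia.
apply/eqP; rewrite -subr_eq0; apply/eqP/cmod_eq0/eqP.
rewrite -sqrf_eq0 sqr_cmodB Rezphi cmod_conj_prod zb (_ : (j - 1 + j)%N = m); last by lia.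
by rewrite -/w -/b -mulr2n mulr_natl subrr.
Qed.

(** Since (a + b) p <= n, the p-th power of the modulus is at most 1 + |f|^n. *)
Lemma Lp_conj_prod a b f : Lp_circle n%:R f -> (a + b <= m)%N ->
  Lp_circle p (conj_prod a b f).
Proof.
move=> [mf If] abm; have [m0 n0] := exponents_gt0.
have mab : measurable_complex (conj_prod a b f).
  rewrite /conj_prod; apply: measurable_complexM.
    elim: a {abm} => [|a IH]; first by split; exact: measurable_cst.
    under eq_fun do rewrite exprS; apply: measurable_complexM => //.
    exact: measurable_complexJ.
  elim: b {abm} => [|b IH]; first by split; exact: measurable_cst.
  by under eq_fun do rewrite exprS; exact: measurable_complexM.
split=> //; apply: (@integrable_le _ _ (fun t => 1 + cmod (f t) `^ n%:R)).
- exact: measurable_cmod_powR.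
- by apply: integrable_addr => //; exact: integrable_circle_cst.
- move=> t _; rewrite ger0_norm ?powR_ge0// cmod_conj_prod -powR_mulrn ?cmod_ge0//.
  rewrite -powRrM; set h := cmod (f t); have h0 : 0 <= h by exact: cmod_ge0.
  have abp : (a + b)%:R * p <= n%:R.
    by rewrite mulrCA ler_piMr ?(ltW n0)// ler_pdivrMr// mul1r ler_nat.
  have abp0 : 0 <= (a + b)%:R * p by rewrite mulr_ge0// ltW// conj_exponent_gt0.
  have [h1|/ltW h1] := leP h 1.
    rewrite ler_wpDr ?powR_ge0//.
    have : h `^ ((a + b)%:R * p) <= 1 `^ ((a + b)%:R * p).
      by apply: ge0_ler_powR; rewrite ?nnegrE.
    by rewrite powR1.
  by rewrite ler_wpDl// ler_powR.
Qed.

(** One factor at a time: partial products of at most m factors stay in L^p, so the same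
    pair of conjugate exponents serves at every step. *)
Lemma fourier_conj_prod_ge0 a b f : Lp_circle n%:R f ->
  (forall k, 0 <= fourier f k) -> (a + b <= m)%N ->
  forall k, 0 <= fourier (conj_prod a b f) k.
Proof.
move=> Lf f0; have [m0 n0] := exponents_gt0.
have n1 : 1 <= n%:R :> R by rewrite ler1n double_predn.
have [Ir Ii] := Lp_circle_integrable n1 Lf.
elim: a => [|a IHa].
  elim: b => [|b IHb] bm k.
    rewrite (_ : conj_prod 0 0 f = fun=> 1); first exact: fourier1_ge0.
    by apply/funext => t; rewrite /conj_prod !expr0 mulr1.
  rewrite (_ : conj_prod 0 b.+1 f = fun t => conj_prod 0 b f t * f t); last first.
    by apply/funext => t; rewrite /conj_prod exprSr mulrA.
  apply: (fourier_mul_ge0 conj_exponent_gt0 n0 conj_exponents _ Lf _ f0).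
    by apply: Lp_conj_prod => //; lia.
  by apply: IHb; lia.
move=> abm k.
rewrite (_ : conj_prod a.+1 b f = fun t => conj_prod a b f t * (f t)^*); last first.
  by apply/funext => t; rewrite /conj_prod exprSr mulrAC.
apply: (fourier_mul_ge0 conj_exponent_gt0 n0 conj_exponents _ (Lp_circleJ Lf)).
- by apply: Lp_conj_prod => //; lia.
- by apply: IHa; lia.
- by move=> l; exact: fourier_conj_ge0.
Qed.

Lemma phi_is_minimal_majorant f : in_Lp n%:R f -> (forall k, 0 <= fourier f k) ->
  minimal_majorant p (phi f) (phi f).
Proof.
move=> f_in f0; have [m0 n0] := exponents_gt0.
have p0 := conj_exponent_gt0; have pq := conj_exponents.
have [pf Lf] := (in_LpP _ n0).1 f_in.
have p1 := conj_exp_ge1 p0 n0 pq.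
have jm : (j - 1 + j <= m)%N by lia.
have Lphi : Lp_circle p (phi f) by exact: Lp_conj_prod.
have phi0 := fourier_conj_prod_ge0 Lf f0 jm.
have [Ipr Ipi] := Lp_circle_integrable p1 Lphi.
have If : intg (fun t => cmod (f t) ^+ n).
  have [_] := Lf; under eq_fun do rewrite powR_mulrn ?cmod_ge0//; exact.
pose B := \int[mu]_(t in C) cmod (f t) ^+ n.
have phiB : \int[mu]_(t in C) cmod (phi f t) `^ p = B.
  by apply: eq_Rintegral => t _; rewrite cmod_phi_powR.
have Fint F : Lp_circle p F -> intg (fun t => Re (F t * (f t)^*)).
  move=> [[Fr Fi] IF]; have [mfJ _] := Lp_circleJ Lf.
  have IY : intg (fun t => p^-1 * cmod (F t) `^ p + n%:R^-1 * cmod (f t) ^+ n).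
    by apply: integrable_addr; exact: integrable_mulr.
  apply: integrable_le IY _; first by have [] := measurable_complexM (conj Fr Fi) mfJ.
  move=> t _; rewrite (le_trans (Re_le_cmod _))// cmodM cmodJ ![_^-1 * _]mulrC.
  rewrite -(@powR_mulrn _ (cmod (f t)))// ?cmod_ge0//.
  by apply: conjugate_powR; rewrite ?cmod_ge0.
(* The integral of phi conj(f) is B, and F - phi has nonnegative coefficients. *)
have majB F : Lp_circle p F -> majorant F (phi f) ->
    B <= \int[mu]_(t in C) Re (F t * (f t)^*).
  move=> LF maj; have [IFr IFi] := Lp_circle_integrable p1 LF.
  have n1 : 1 <= n%:R :> R by rewrite ler1n double_predn.
  have [Ifr Ifi] := Lp_circle_integrable n1 Lf.
  have : 0 <= Cintegral C (fun t => (F t - phi f t) * (f t)^*).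
    apply: (Cintegral_mul_ge0 p0 n0 pq (Lp_circleB p0 LF Lphi) (Lp_circleJ Lf)).
      move=> k; rewrite fourierB// subr_ge0.
      by have := maj k; rewrite (ger0_norm (phi0 k)).
    by move=> k; exact: fourier_conj_ge0.
  rewrite lecE /Cintegral/= => /andP[_]; congr (is_true _).
  rewrite -[RHS]subr_ge0 /B -RintegralB//; last exact: Fint.
  congr (_ <= _); apply: eq_Rintegral => t _.
  by rewrite mulrBl raddfB/= Re_phiJ.
have youngB F : Lp_circle p F ->
  \int[mu]_(t in C) (p^-1 * cmod (F t) `^ p + n%:R^-1 * cmod (f t) ^+ n) =
  p^-1 * \int[mu]_(t in C) cmod (F t) `^ p + n%:R^-1 * B.
  by move=> [_ IF]; rewrite RintegralD ?RintegralZl//; exact: integrable_mulr.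
have youngI F : Lp_circle p F ->
    intg (fun t => p^-1 * cmod (F t) `^ p + n%:R^-1 * cmod (f t) ^+ n).
  by move=> [_ IF]; apply: integrable_addr; exact: integrable_mulr.
have young F t : Re (F t * (f t)^*) <= p^-1 * cmod (F t) `^ p + n%:R^-1 * cmod (f t) ^+ n.
  by rewrite ![_^-1 * _]mulrC; exact: young_cmod.
(* As 1/p + 1/n = 1, the Young bound for F = phi is B itself, so that comparing
   it with [majB] compares the integrals of |phi|^p and |F|^p. *)
have BE : B = p^-1 * B + n%:R^-1 * B by rewrite -mulrDl pq mul1r.
have in_phi : in_Lp p (phi f).
  by apply/(in_LpP _ p0); split=> // t; rewrite /conj_prod pf.
split.
  split; [exact: in_phi|by move=> k; rewrite ger0_norm|].
  move=> F /(in_LpP _ p0)[_ LF] maj; rewrite Lp_norm_le// phiB.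
  have : B <= p^-1 * \int[mu]_(t in C) cmod (F t) `^ p + n%:R^-1 * B.
    rewrite -youngB//; apply: le_trans (majB F LF maj) _.
    by apply: le_Rintegral => //; [exact: Fint|exact: youngI].
  by rewrite {1}BE lerD2r ler_pM2l ?invr_gt0.
move=> F [/(in_LpP _ p0)[_ LF] majF leastF].
have := leastF _ in_phi; rewrite Lp_norm_le// phiB => /(_ _) FB.
have {}FB : \int[mu]_(t in C) cmod (F t) `^ p <= B.
  by apply: FB => k; rewrite ger0_norm.
(* The Young defect of F is nonnegative and has integral at most 0. *)
pose u t := (p^-1 * cmod (F t) `^ p + n%:R^-1 * cmod (f t) ^+ n) - Re (F t * (f t)^*).
have u0 t : 0 <= u t by rewrite subr_ge0.
have Iu : intg u by apply: integrable_subr; [exact: youngI|exact: Fint].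
have intu : \int[mu]_(t in C) u t = 0.
  apply/le_anti/andP; split; last by apply: Rintegral_ge0 => t _; exact: u0.
  rewrite RintegralB//; [|exact: youngI|exact: Fint].
  rewrite subr_le0 youngB// (le_trans _ (majB F LF majF))// [leRHS]BE lerD2r.
  by rewrite ler_pM2l ?invr_gt0.
have := (@ae_eq_integral_abs _ _ R mu C measurable_circle (EFin \o u) _).1.
case.
- by have /integrableP[] := Iu.
- have -> : (\int[mu]_(t in C) `|(EFin \o u) t| = \int[mu]_(t in C) (u t)%:E)%E.
    by apply: eq_integral => t _; rewrite gee0_abs// lee_fin.
  by rewrite -[LHS]fineK ?integrable_fin_num// -[fine _]/(Rintegral _ _ _) intu.
move=> N [mN N0 uN]; exists N; split=> // t /= nFphi; apply: uN => /= ut.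
apply: nFphi => Ct; apply: young_cmod_eq; have [] := ut Ct => /eqP.
by rewrite subr_eq0 => /eqP <-; rewrite ![_^-1 * _]mulrC.
Qed.
End even_exponent.
End complex_circle.

Local Open Scope complex_scope.

Theorem corollary1p6 (R : realType) (j : nat) (hj : (1 < j)%N)
    (p : R) (hp : p = (2 * j)%:R / (2 * j - 1)%:R)
    (H : R -> R[i]) (hH : in_Lp (2 * j)%:R H)
    (hH_ge0 : forall n : int, 0 <= fourier H n) :
  let G : R -> R[i] := fun t => (H t)^* ^+ (j - 1) * H t ^+ j in
  minimal_majorant p G G.
Proof. by rewrite hp; exact: phi_is_minimal_majorant. Qed.
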